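(* Let $H\subset GL_{q,r}(N+1)$ be the space of all sums of monomials containing at least one factor of the kind $T^0{}_a$, $a\in\{1,\dots,N\}$. Then $H$ is a Hopf ideal in $GL_{q,r}(N+1)$, that is: i) $H$ is a two-sided ideal in $GL_{q,r}(N+1)$; ii) $H$ is a co-ideal, i.e. $\Delta_{N+1}(H)\subseteq H\otimes GL_{q,r}(N+1)+GL_{q,r}(N+1)\otimes H$ and $\varepsilon_{N+1}(H)=0$; iii) $H$ is compatible with the antipode: $\kappa_{N+1}(H)\subseteq H$.
   Context: Indices $A,B,\dots$ run over $\{0,1,\dots,N\}$, lower-case $a,b,\dots$ over $\{1,\dots,N\}$; repeated indices are summed. $r$ and $q_{AB}$ are nonzero complex parameters with $q_{AB}=r^2/q_{BA}$, $q_{AA}=r$. Let $\theta^{AB}=1$ for $A>B$ and $0$ otherwise, and $$R^{AB}{}_{CD}=\delta^A_C\delta^B_D\Big[\frac{r}{q_{AB}}+(r-1)\delta^{AB}\Big]+(r-r^{-1})\,\delta^A_D\delta^B_C\,\theta^{AB}.$$ $GL_{q,r}(N+1)$ is the unital $\mathbf C$-algebra generated by $T^A{}_B$ and $\Xi$ modulo $R^{AB}{}_{EF}T^E{}_CT^F{}_D=T^B{}_FT^A{}_ER^{EF}{}_{CD}$ and $\Xi\det T=\det T\,\Xi=I$, where $$\det T=\sum_\sigma\Big[\prod_{A<B,\ \sigma(A)>\sigma(B)}\Big(-\frac{r^2}{q_{\sigma(B)\sigma(A)}}\Big)\Big]T^0{}_{\sigma(0)}\cdots T^N{}_{\sigma(N)}$$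 (sum over permutations $\sigma$ of $\{0,\dots,N\}$). It is a Hopf algebra with $\Delta_{N+1}(T^A{}_B)=T^A{}_C\otimes T^C{}_B$, $\varepsilon_{N+1}(T^A{}_B)=\delta^A_B$, $\kappa_{N+1}(T^A{}_B)=(T^{-1})^A{}_B$ (the matrix inverse), $\Delta_{N+1}(\Xi)=\Xi\otimes\Xi$, $\varepsilon_{N+1}(\Xi)=1$, $\kappa_{N+1}(\Xi)=\det T$. *)

(* Defs.v *)
From HB Require Import structures.
From mathcomp Require Import all_boot all_order all_algebra.
From mathcomp Require Import perm finmap monalg complex.
From mathcomp Require Import boolp classical_sets reals.

Set Implicit Arguments.
Unset Strict Implicit.
Unset Printing Implicit Defensive.

Import GRing.Theory.
Local Open Scope ring_scope.

Section Span.
Variables (K : fieldType) (V : lmodType K).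

Definition span (P : set V) : set V :=
  [set v | exists2 s : seq (K * V),
     forall p, p \in s -> P p.2 & v = \sum_(p <- s) p.1 *: p.2]%classic.

Lemma span_sub P v : P v -> span P v.
Proof.
move=> Pv; exists [:: (1, v)] => [p|]; first by rewrite inE => /eqP ->.
by rewrite big_seq1 scale1r.
Qed.

Lemma span0 P : span P 0.
Proof. by exists [::]; rewrite ?big_nil. Qed.

Lemma spanD P u v : span P u -> span P v -> span P (u + v).
Proof.
move=> [s sP ->] [t tP ->]; exists (s ++ t); last by rewrite big_cat.
by move=> p; rewrite mem_cat => /orP[/sP|/tP].
Qed.

Lemma spanZ P c v : span P v -> span P (c *: v).
Proof.
move=> [s sP ->]; exists [seq (c * p.1, p.2) | p <- s].
  by move=> p /mapP[p' /sP Pp' ->].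
by rewrite big_map scaler_sumr; apply: eq_bigr => p _; rewrite scalerA.
Qed.

Lemma spanB P u v : span P u -> span P v -> span P (u - v).
Proof. by move=> Pu Pv; rewrite -scaleN1r; apply/spanD/spanZ. Qed.

Lemma span_ind (P Q : set V) : Q 0 -> (forall u v, Q u -> Q v -> Q (u + v)) ->
  (forall c v, P v -> Q (c *: v)) -> forall v, span P v -> Q v.
Proof.
move=> Q0 QD QZ v [s sP ->]; elim: s sP => [|p s IHs] sP; first by rewrite big_nil.
rewrite big_cons; apply: QD; first by apply/QZ/sP; rewrite mem_head.
by apply: IHs => p' p's; apply: sP; rewrite inE p's orbT.
Qed.

Definition spanb (P : set V) : V -> bool := fun v => `[< span P v >].

Lemma spanb_zmod P : zmod_closed (spanb P).
Proof.
split; first exact/asboolP/span0.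
by move=> u v /asboolP Pu /asboolP Pv; apply/asboolP/spanB.
Qed.


Definition span_closed P : zmodClosed V := HB.pack (spanb P)
  (GRing.isZmodClosed.Build V (spanb P) (spanb_zmod P)).

Definition quotmod (P : set V) : Type := @Quotient.quot V (span_closed P).
HB.instance Definition _ P := GRing.Zmodule.on (quotmod P).

Variable P : set V.

Definition qpi (v : V) : quotmod P := (\pi_(@Quotient.quot V (span_closed P)) v)%qT.

Lemma qpiP u v : qpi u = qpi v <-> span P (u - v).
Proof.
split=> [/eqP|Puv]; first by rewrite /qpi -Quotient.idealrBE => /asboolP.
by apply/eqP; rewrite /qpi -Quotient.idealrBE; apply/asboolP.
Qed.

Lemma qpi0 v : qpi v = 0 <-> span P v.
Proof.
have -> : 0 = qpi 0 by rewrite /qpi raddf0.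
by rewrite -[X in span _ X]subr0; apply: qpiP.
Qed.

Lemma qpi_surj (x : quotmod P) : {v | x = qpi v}.
Proof. by exists (repr x); rewrite /qpi reprK. Qed.

Lemma qpi_repr v : span P (v - repr (qpi v)).
Proof. by apply/qpiP; rewrite /qpi reprK. Qed.

Lemma qpi_zmod : zmod_morphism qpi.
Proof. by move=> u v; rewrite /qpi raddfB. Qed.
HB.instance Definition _ := GRing.isZmodMorphism.Build V (quotmod P) qpi qpi_zmod.

Definition qscale c (x : quotmod P) : quotmod P := qpi (c *: repr x).

Lemma qscale_pi c v : qscale c (qpi v) = qpi (c *: v).
Proof.
apply/qpiP; rewrite -scalerBr -opprB scalerN -scaleNr.
exact/spanZ/qpi_repr.
Qed.

Lemma qscaleA a b x : qscale a (qscale b x) = qscale (a * b) x.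
Proof. by have [v ->] := qpi_surj x; rewrite !qscale_pi scalerA. Qed.

Lemma qscale1 : left_id 1 qscale.
Proof. by move=> x; have [v ->] := qpi_surj x; rewrite qscale_pi scale1r. Qed.

Lemma qscaleDr : right_distributive qscale +%R.
Proof.
move=> c x y; have [u ->] := qpi_surj x; have [v ->] := qpi_surj y.
by rewrite -raddfD !qscale_pi scalerDr raddfD.
Qed.

Lemma qscaleDl x : {morph qscale^~ x : a b / a + b}.
Proof.
by move=> a b; have [v ->] := qpi_surj x; rewrite !qscale_pi scalerDl raddfD.
Qed.

HB.instance Definition _ :=
  GRing.Zmodule_isLmodule.Build K (quotmod P) qscaleA qscale1 qscaleDr qscaleDl.

Lemma qpi_scalable : scalable qpi.
Proof. by move=> c v; rewrite -qscale_pi. Qed.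
HB.instance Definition _ := GRing.isScalable.Build K V (quotmod P) *:%R qpi qpi_scalable.

End Span.

Section Tensor.
Variable K : fieldType.

Section Def.
Variables A B : lmodType K.

Definition tens_rel : set {malg K[(A * B)%type]} :=
  [set z | [\/ exists a a' b, z = << (a + a', b) >> - << (a, b) >> - << (a', b) >>,
               exists a b b', z = << (a, b + b') >> - << (a, b) >> - << (a, b') >>,
               exists c a b, z = << (c *: a, b) >> - c *: << (a, b) >> |
               exists c a b, z = << (a, c *: b) >> - c *: << (a, b) >> ]]%classic.

Definition tens : Type := quotmod tens_rel.
HB.instance Definition _ := GRing.Lmodule.on tens.

(* Locked (as is tlift below): otherwise failing unification problems between
   pure tensors unfold down to the finitely supported functions. *)
Fact ten_key : unit. Proof. by []. Qed.
Definition ten : A -> B -> tens :=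
  locked_with ten_key (fun a b => qpi tens_rel << (a, b) >>).

Lemma ten_def a b : ten a b = qpi tens_rel << (a, b) >>.
Proof. by rewrite /ten unlock. Qed.

Lemma tenDl a a' b : ten (a + a') b = ten a b + ten a' b.
Proof.
rewrite !ten_def -raddfD; apply/qpiP/span_sub; apply: Or41.
by exists a, a', b; rewrite opprD addrA.
Qed.

Lemma tenDr a b b' : ten a (b + b') = ten a b + ten a b'.
Proof.
rewrite !ten_def -raddfD; apply/qpiP/span_sub; apply: Or42.
by exists a, b, b'; rewrite opprD addrA.
Qed.

Lemma tenZl c a b : ten (c *: a) b = c *: ten a b.
Proof.
rewrite !ten_def -linearZ; apply/qpiP/span_sub; apply: Or43.
by exists c, a, b.
Qed.

Lemma tenZr c a b : ten a (c *: b) = c *: ten a b.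
Proof.
rewrite !ten_def -linearZ; apply/qpiP/span_sub; apply: Or44.
by exists c, a, b.
Qed.

Lemma tens_ind (Q : tens -> Prop) : (forall u v, Q u -> Q v -> Q (u + v)) ->
  (forall a b, Q (ten a b)) -> forall x, Q x.
Proof.
move=> QD Qt x; have [g ->] := qpi_surj x.
rewrite [g]monalgE; elim: (enum_fset _) => [|[a b] s IHs].
  by rewrite big_nil raddf0 -[0](scale0r (ten 0 0)) -tenZl; apply: Qt.
rewrite big_cons raddfD; apply: QD => //.
suff -> : << g@_(a, b) *g (a, b) >> = g@_(a, b) *: << (a, b) >>.
  by rewrite /= qpi_scalable -ten_def -tenZl; apply: Qt.
by apply/malgP => k; rewrite mcoeffZ !mcoeffU mulrnAr mulr1.
Qed.

End Def.

Section Lift.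
Variables A B V : lmodType K.

Definition bilin (f : A -> B -> V) : Prop :=
  (forall b, linear (f^~ b)) /\ (forall a, linear (f a)).

(* The linear map a (x) b |-> f a b when f is bilinear; junk otherwise. *)
Fact tlift_key : unit. Proof. by []. Qed.
Definition tlift : (A -> B -> V) -> tens A B -> V :=
  locked_with tlift_key (fun f x =>
    \sum_(p <- msupp (repr x)) (repr x)@_p *: f p.1 p.2).

Variable f : A -> B -> V.

Let flift (g : {malg K[(A * B)%type]}) : V :=
  \sum_(p <- msupp g) g@_p *: f p.1 p.2.

Let fliftw (d : {fset A * B}) g : (msupp g `<=` d)%fset ->
  flift g = \sum_(p <- d) g@_p *: f p.1 p.2.
Proof.
move=> le; rewrite /flift; apply: (big_fset_incl _ le) => //= p _.
by move=> /mcoeff_outdom ->; rewrite scale0r.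
Qed.

Let flift_lin : linear flift.
Proof.
move=> c u v; set d := (msupp u `|` msupp v)%fset.
rewrite !(@fliftw d) ?fsubsetUl ?fsubsetUr //; last first.
  apply: fsubset_trans (msuppD_le _ _) _; apply: fsetSU; exact: msuppZ_le.
rewrite scaler_sumr -big_split; apply: eq_bigr => p _ /=.
by rewrite mcoeffD mcoeffZ scalerDl scalerA.
Qed.

Let fliftU p : flift << p >> = f p.1 p.2.
Proof. by rewrite (fliftw msuppU_le) big_seq_fset1 mcoeffUU scale1r. Qed.

Hypothesis fbilin : bilin f.

Let flift_pi g : tlift f (qpi _ g) = flift g.
Proof.
have F0 : flift 0 = 0 by rewrite /flift msupp0 big_seq_fset0.
have FD u v : flift (u + v) = flift u + flift v.
  by have := flift_lin 1 u v; rewrite !scale1r.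
have FZ c v : flift (c *: v) = c *: flift v.
  by have := flift_lin c v 0; rewrite F0 !addr0.
have FB u v : flift (u - v) = flift u - flift v.
  by rewrite FD -[- v]scaleN1r FZ scaleN1r.
have [fl fr] := fbilin.
have fDl a a' b : f (a + a') b = f a b + f a' b.
  by have := fl b 1 a a'; rewrite !scale1r.
have fDr a b b' : f a (b + b') = f a b + f a b'.
  by have := fr a 1 b b'; rewrite !scale1r.
have f0l b : f 0 b = 0.
  by rewrite -[RHS](addNr (f 0 b)) -scaleN1r -fl scaler0 addr0.
have f0r a : f a 0 = 0.
  by rewrite -[RHS](addNr (f a 0)) -scaleN1r -fr scaler0 addr0.
have fZl c a b : f (c *: a) b = c *: f a b.
  by have := fl b c a 0; rewrite !addr0 f0l addr0.
have fZr c a b : f a (c *: b) = c *: f a b.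
  by have := fr a c b 0; rewrite !addr0 f0r addr0.
rewrite /tlift unlock -/(flift _); apply/esym/eqP; rewrite -subr_eq0 -FB.
apply/eqP; move: (qpi_repr (@tens_rel A B) g).
apply: (@span_ind _ _ _ (fun z => flift z = 0)) => // [u v Fu Fv|c v Rv].
  by rewrite FD Fu Fv addr0.
suff Fv : flift v = 0 by rewrite FZ Fv scaler0.
case: Rv => [[a [a' [b ->]]]|[a [b [b' ->]]]|[c' [a [b ->]]]|[c' [a [b ->]]]];
  rewrite FB.
- by rewrite FB !fliftU fDl addrAC addrK subrr.
- by rewrite FB !fliftU fDr addrAC addrK subrr.
- by rewrite FZ !fliftU fZl subrr.
- by rewrite FZ !fliftU fZr subrr.
Qed.

Lemma tlift_lin : linear (tlift f).
Proof.
move=> c x y; have [u ->] := qpi_surj x; have [v ->] := qpi_surj y.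
by rewrite -linearP !flift_pi flift_lin.
Qed.

Lemma tliftE a b : tlift f (ten a b) = f a b.
Proof. by rewrite ten_def flift_pi fliftU. Qed.

End Lift.

Definition tmap (A B A' B' : lmodType K) (f : A -> A') (g : B -> B') :
  tens A B -> tens A' B' := tlift (fun a b => ten (f a) (g b)).

Definition tassoc (A B C : lmodType K) (x : tens (tens A B) C) :
  tens A (tens B C) :=
  tlift (fun y c => tlift (fun a b => ten a (ten b c)) y) x.

Section Lemmas.

Lemma ten_bilin (A B : lmodType K) : bilin (@ten A B).
Proof. by split=> [b c a a'|a c b b']; rewrite ?tenDl ?tenDr ?tenZl ?tenZr. Qed.

Lemma tmap_bilin (A B A' B' : lmodType K) (f : A -> A') (g : B -> B') :
  linear f -> linear g -> bilin (fun a b => ten (f a) (g b)).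
Proof.
by move=> fL gL; split=> [b c a a'|a c b b'];
  rewrite ?fL ?gL ?tenDl ?tenDr ?tenZl ?tenZr.
Qed.

Lemma tmapE (A B A' B' : lmodType K) (f : A -> A') (g : B -> B') a b :
  linear f -> linear g -> tmap f g (ten a b) = ten (f a) (g b).
Proof. by move=> fL gL; rewrite /tmap tliftE //; apply: tmap_bilin. Qed.

Lemma tens_lin_ext (A B V : lmodType K) (f g : tens A B -> V) :
  linear f -> linear g -> (forall a b, f (ten a b) = g (ten a b)) -> f =1 g.
Proof.
move=> fL gL fg; apply: tens_ind => // u v; rewrite -[u]scale1r fL gL.
by rewrite !scale1r => -> ->.
Qed.

Lemma comb_linear (V W : lmodType K) k (f g : V -> W) :
  linear f -> linear g -> linear (fun y => k *: f y + g y).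
Proof.
move=> fL gL c u v; rewrite fL gL !scalerDr !scalerA (mulrC k) -!addrA.
by congr (_ + _); rewrite addrCA.
Qed.

Lemma tassocE (A B C : lmodType K) (a : A) (b : B) (c : C) :
  tassoc (ten (ten a b) c) = ten a (ten b c).
Proof.
have bil d : bilin (fun (a : A) (b : B) => ten a (ten b (d : C))).
  by split=> [y k x x'|x k y y']; rewrite ?(tenDl, tenDr, tenZl, tenZr).
rewrite /tassoc !tliftE //; split=> [d k y y'|y k d d'].
  by rewrite (tlift_lin (bil d)).
apply: (@tens_lin_ext _ _ _ (tlift _) (fun y => k *: tlift _ y + tlift _ y)).
- exact: tlift_lin.
- by apply: comb_linear; apply: tlift_lin.
- by move=> x x'; rewrite !tliftE // !(tenDr, tenZr).
Qed.

End Lemmas.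

Section Alg.
Variables A B : algType K.

Definition tmul (x y : tens A B) : tens A B :=
  tlift (fun a b => tlift (fun a' b' => ten (a * a') (b * b')) y) x.

Let bil a b : bilin (fun (a' : A) (b' : B) => ten (a * a') (b * b')).
Proof.
by split=> [y k x x'|x k y y']; rewrite mulrDr -scalerAr ?(tenDl, tenDr, tenZl, tenZr).
Qed.

Let bil2 y : bilin (fun a b => tlift (fun a' b' => ten (a * a') (b * b')) y : tens A B).
Proof.
split=> [b k a a'|a k b b'];
  apply: (@tens_lin_ext _ _ _ (tlift _) (fun y => k *: tlift _ y + tlift _ y));
  do ?exact: tlift_lin; do ?by apply: comb_linear; apply: tlift_lin.
all: by move=> x x'; rewrite !tliftE // mulrDl -scalerAl ?(tenDl, tenDr, tenZl, tenZr).
Qed.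

Lemma tmulE a b a' b' : tmul (ten a b) (ten a' b') = ten (a * a') (b * b').
Proof. by rewrite /tmul !tliftE. Qed.

Lemma tmul_linl y : linear (tmul^~ y).
Proof. exact: tlift_lin. Qed.

Lemma tmul_linr x : linear (tmul x).
Proof.
elim/tens_ind: x => [u v IHu IHv|a b] k y y'; last first.
  by rewrite /tmul !tliftE // (tlift_lin (bil _ _)).
have mulD z : tmul (u + v) z = tmul u z + tmul v z.
  by have := tmul_linl z 1 u v; rewrite !scale1r.
by rewrite !mulD IHu IHv scalerDr !addrA; congr (_ + _); rewrite addrAC.
Qed.

Lemma tmulDl : left_distributive tmul +%R.
Proof. by move=> x y z; have := tmul_linl z 1 x y; rewrite !scale1r. Qed.

Lemma tmulDr : right_distributive tmul +%R.
Proof. by move=> x y z; have := tmul_linr x 1 y z; rewrite !scale1r. Qed.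

Lemma tmulA : associative tmul.
Proof.
elim/tens_ind=> [u v IHu IHv|a b] y z; first by rewrite !tmulDl IHu IHv.
elim/tens_ind: y => [u v IHu IHv|a' b']; first by rewrite !(tmulDl, tmulDr) IHu IHv.
elim/tens_ind: z => [u v IHu IHv|a'' b'']; first by rewrite !tmulDr IHu IHv.
by rewrite !tmulE !mulrA.
Qed.

Lemma tmul1 : left_id (ten 1 1) tmul.
Proof.
elim/tens_ind=> [u v IHu IHv|a b]; first by rewrite tmulDr IHu IHv.
by rewrite tmulE !mul1r.
Qed.

Lemma tmul_1 : right_id (ten 1 1) tmul.
Proof.
elim/tens_ind=> [u v IHu IHv|a b]; first by rewrite tmulDl IHu IHv.
by rewrite tmulE !mulr1.
Qed.

HB.instance Definition _ := GRing.Zmodule_isPzRing.Build (tens A B)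
  tmulA tmul1 tmul_1 tmulDl tmulDr.

End Alg.

End Tensor.

Notation "a ⊗ b" := (ten a b) (at level 40, left associativity) : ring_scope.

Section Hopf.
Variable K : fieldType.

(* In the counit and antipode axioms, tlift (fun a b => f a * g b) is the composite
   of f (x) g with the multiplication (or with K (x) A = A). *)
Record hopf_structure (A : algType K) := HopfStructure {
  comul : {lrmorphism A -> tens A A};
  counit : {lrmorphism A -> K | *%R};
  antipode : {linear A -> A};
  comulA : forall x : A,
    tassoc (tmap comul idfun (comul x)) = tmap idfun comul (comul x);
  counitl : forall x : A, tlift (fun a b => counit a *: b) (comul x) = x;
  counitr : forall x : A, tlift (fun a b => counit b *: a) (comul x) = x;
  antipodel : forall x : A,
    tlift (fun a b => antipode a * b) (comul x) = (counit x)%:A;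
  antipoder : forall x : A,
    tlift (fun a b => a * antipode b) (comul x) = (counit x)%:A }.

Variables (A : algType K) (S : hopf_structure A).
Local Open Scope classical_set_scope.

Definition two_sided_ideal (H : set A) : Prop :=
  [/\ H 0, forall x y, H x -> H y -> H (x + y) &
      forall a x, H x -> H (a * x) /\ H (x * a)].

(* The image of U (x) V in A (x) A. *)
Definition tens_sub (U V : set A) : set (tens A A) :=
  span [set z | exists u v, [/\ U u, V v & z = u ⊗ v]].

Definition coideal (H : set A) : Prop :=
  (forall x, H x -> exists y z,
     [/\ tens_sub H setT y, tens_sub setT H z & comul S x = y + z]) /\
  (forall x, H x -> counit S x = 0).

Definition hopf_ideal (H : set A) : Prop :=
  [/\ two_sided_ideal H, coideal H & antipode S @` H `<=` H].

End Hopf.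

Section FreeAlg.
Variables (K : fieldType) (X : choiceType).

Lemma malg_scalerAr (k : K) (x y : {malg K[{fmonom X}]}) :
  k *: (x * y) = x * (k *: y).
Proof.
have comm_k (z : {malg K[{fmonom X}]}) : z * k%:MP = k *: z.
  rewrite -mul_malgC [RHS]malgM_def fgmulUg malgM_def fgmulgU.
  by apply: eq_bigr => m _; rewrite mulm1 mul1m mulrC.
by rewrite -[k *: y]mul_malgC mulrA comm_k scalerAl.
Qed.

Definition freealg : Type := {malg K[{fmonom X}]}.
HB.instance Definition _ := GRing.Lalgebra.on freealg.
HB.instance Definition _ :=
  GRing.Lalgebra_isAlgebra.Build K freealg malg_scalerAr.

Definition freegen (x : X) : freealg := << fmu x >>.

End FreeAlg.

Section QuotAlg.
Variables (K : fieldType) (F : algType K) (P : set F).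

Definition ideal_gens : set F := [set z | exists a p b, P p /\ z = a * p * b]%classic.

Definition quotalg : Type := quotmod ideal_gens.
HB.instance Definition _ := GRing.Lmodule.on quotalg.

Definition qalg_pi (x : F) : quotalg := qpi ideal_gens x.
HB.instance Definition _ :=
  GRing.isZmodMorphism.Build F quotalg qalg_pi (@qpi_zmod _ _ ideal_gens).
HB.instance Definition _ :=
  GRing.isScalable.Build K F quotalg *:%R qalg_pi (@qpi_scalable _ _ ideal_gens).

Lemma ideal_mull a x : span ideal_gens x -> span ideal_gens (a * x).
Proof.
apply: (@span_ind _ _ _ (fun x => span ideal_gens (a * x))) => [|u v Iu Iv|c v].
- by rewrite mulr0; apply: span0.
- by rewrite mulrDr; apply: spanD.
case=> [b [p [b' [Pp ->]]]]; rewrite -scalerAr !mulrA; apply/spanZ/span_sub.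
by exists (a * b), p, b'.
Qed.

Lemma ideal_mulr a x : span ideal_gens x -> span ideal_gens (x * a).
Proof.
apply: (@span_ind _ _ _ (fun x => span ideal_gens (x * a))) => [|u v Iu Iv|c v].
- by rewrite mul0r; apply: span0.
- by rewrite mulrDl; apply: spanD.
case=> [b [p [b' [Pp ->]]]]; rewrite -scalerAl -!mulrA; apply/spanZ/span_sub.
by exists b, p, (b' * a); rewrite !mulrA.
Qed.

Definition qmul (x y : quotalg) : quotalg := qalg_pi (repr x * repr y).

Lemma qmul_pi u v : qmul (qalg_pi u) (qalg_pi v) = qalg_pi (u * v).
Proof.
apply/esym/qpiP; set u' := repr _; set v' := repr _.
have -> : u * v - u' * v' = (u - u') * v + u' * (v - v').
  by rewrite mulrBl mulrBr addrA subrK.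
by apply: spanD; [apply: ideal_mulr|apply: ideal_mull]; apply: qpi_repr.
Qed.

Lemma qalg_surj (x : quotalg) : {v | x = qalg_pi v}.
Proof. exact: qpi_surj. Qed.

Lemma qmulA : associative qmul.
Proof.
move=> x y z; have [u ->] := qalg_surj x; have [v ->] := qalg_surj y.
by have [w ->] := qalg_surj z; rewrite !qmul_pi mulrA.
Qed.

Lemma qmul1 : left_id (qalg_pi 1) qmul.
Proof. by move=> x; have [u ->] := qalg_surj x; rewrite qmul_pi mul1r. Qed.

Lemma qmul_1 : right_id (qalg_pi 1) qmul.
Proof. by move=> x; have [u ->] := qalg_surj x; rewrite qmul_pi mulr1. Qed.

Lemma qmulDl : left_distributive qmul +%R.
Proof.
move=> x y z; have [u ->] := qalg_surj x; have [v ->] := qalg_surj y.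
by have [w ->] := qalg_surj z; rewrite -raddfD !qmul_pi mulrDl raddfD.
Qed.

Lemma qmulDr : right_distributive qmul +%R.
Proof.
move=> x y z; have [u ->] := qalg_surj x; have [v ->] := qalg_surj y.
by have [w ->] := qalg_surj z; rewrite -raddfD !qmul_pi mulrDr raddfD.
Qed.

HB.instance Definition _ := GRing.Zmodule_isPzRing.Build quotalg
  qmulA qmul1 qmul_1 qmulDl qmulDr.

Lemma qalg_pi_monoid : monoid_morphism qalg_pi.
Proof. by split=> [|x y]; [|rewrite -qmul_pi]. Qed.
HB.instance Definition _ :=
  GRing.isMonoidMorphism.Build F quotalg qalg_pi qalg_pi_monoid.

Lemma qalg_scalerAl (k : K) (x y : quotalg) : k *: (x * y) = (k *: x) * y.
Proof.
have [u ->] := qalg_surj x; have [v ->] := qalg_surj y.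
by rewrite -rmorphM -!linearZ -rmorphM scalerAl.
Qed.

Lemma qalg_scalerAr (k : K) (x y : quotalg) : k *: (x * y) = x * (k *: y).
Proof.
have [u ->] := qalg_surj x; have [v ->] := qalg_surj y.
by rewrite -rmorphM -!linearZ -rmorphM scalerAr.
Qed.

Lemma qalg_neq0 (e : {lrmorphism F -> K | *%R}) :
  (forall p, P p -> e p = 0) -> (1 : quotalg) != 0.
Proof.
move=> eP; apply/eqP => /qpi0 I1.
suff : e 1 = 0 by move/eqP; rewrite rmorph1 oner_eq0.
apply: (@span_ind _ _ _ (fun x => e x = 0)) I1 => [|u v eu ev|c v].
- by rewrite raddf0.
- by rewrite raddfD /= eu ev addr0.
case=> [a [p [b [/eP ep ->]]]].
by rewrite linearZ /= !rmorphM /= ep mulr0 mul0r mulr0.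
Qed.

End QuotAlg.

Section QuantumGL.
Variables (K : fieldType) (N : nat) (r : K) (q : 'I_N.+1 -> 'I_N.+1 -> K).
Local Notation I := 'I_N.+1.

(* Rmat A B C D is R^{AB}_{CD}, with theta^{AB} = (B < A). *)
Definition Rmat (A B C D : I) : K :=
  (A == C)%:R * (B == D)%:R * (r / q A B + (r - 1) * (A == B)%:R)
  + (r - r^-1) * (A == D)%:R * (B == C)%:R * (B < A)%N%:R.

(* The matrix entries do not commute: each product is taken in increasing order
   of the row index, T^0_{s(0)} ... T^N_{s(N)}. *)
Definition qdet (M : algType K) (t : 'M[M]_N.+1) : M :=
  \sum_(s : 'S_N.+1)
    (\prod_(p : I * I | (p.1 < p.2)%N && (s p.2 < s p.1)%N)
        - (r ^+ 2 / q (s p.2) (s p.1)))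
    *: \prod_(A < N.+1) t A (s A).

(* Some (A, B) stands for T^A_B and None for Xi. *)
Definition GLgen : choiceType := option (I * I).

Definition freeT : 'M[freealg K GLgen]_N.+1 :=
  \matrix_(A, B) freegen K (Some (A, B) : GLgen).
Definition freeXi : freealg K GLgen := freegen K (None : GLgen).

Definition GLrel : set (freealg K GLgen) :=
  [set z | [\/ exists A B C D,
                 z = \sum_(E < N.+1) \sum_(F < N.+1)
                       Rmat A B E F *: (freeT E C * freeT F D)
                     - \sum_(E < N.+1) \sum_(F < N.+1)
                       Rmat E F C D *: (freeT B F * freeT A E),
               z = freeXi * qdet freeT - 1 |
               z = qdet freeT * freeXi - 1]]%classic.

Definition GL : Type := quotalg GLrel.
HB.instance Definition _ := GRing.PzRing.on GL.
HB.instance Definition _ := GRing.Lmodule.on GL.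

Let eps_gen (m : {fmonom GLgen}) : K :=
  \prod_(g <- m) (if g is Some (A, B) then (A == B)%:R else 1).

Let eps_genM : mmorphism eps_gen.
Proof.
split=> [x y|]; first by rewrite /eps_gen fmM big_cat.
by rewrite /eps_gen fm1 big_nil.
Qed.

HB.instance Definition _ := isMultiplicative.Build {fmonom GLgen} K eps_gen eps_genM.

Lemma freealg_eps : exists e : {lrmorphism freealg K GLgen -> K | *%R},
  (forall A B, e (freeT A B) = (A == B)%:R) /\ e freeXi = 1.
Proof.
exists (mmap idfun eps_gen : {lrmorphism {malg K[{fmonom GLgen}]} -> K | *%R}).
split=> [A B|] /=; first by rewrite mxE /freegen mmapU mul1r /eps_gen fmU big_seq1.
by rewrite mmapU mul1r /eps_gen fmU big_seq1.
Qed.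

Lemma GL_neq0 : (1 : GL) != 0.
Proof.
have [e [eT eXi]] := freealg_eps.
have eZM c A B C D : e (c *: (freeT A B * freeT C D)) = c * ((A == B)%:R * (C == D)%:R).
  by rewrite linearZ /= rmorphM /= !eT.
have eB u v : e (u - v) = e u - e v by rewrite raddfB.
have edet : e (qdet freeT) = 1.
  pose w (s : 'S_N.+1) : K := \prod_(p : I * I | (p.1 < p.2)%N && (s p.2 < s p.1)%N)
    - (r ^+ 2 / q (s p.2) (s p.1)).
  have es (s : 'S_N.+1) : e (w s *: \prod_(A < N.+1) freeT A (s A)) = (s == 1%g)%:R.
    rewrite linearZ /= rmorph_prod; case: eqVneq => [->|s1].
      rewrite [X in _ * X]big1 => [|A _]; last by rewrite perm1 [LHS]eT eqxx.
      rewrite mulr1 /w big1 // => p /andP[lt12]; rewrite !perm1 => lt21.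
      by have := ltn_trans lt12 lt21; rewrite ltnn.
    have [A sA] : exists A, s A != A.
      apply/existsP; apply: contraR s1 => /existsPn s1; apply/eqP/permP => A.
      by rewrite perm1; apply/eqP; have := s1 A; rewrite negbK.
    have eA : e (freeT A (s A)) = 0 by rewrite eT eq_sym (negbTE sA).
    by rewrite (bigD1 A) //= [X in _ * (X * _)]eA mul0r mulr0.
  rewrite raddf_sum (eq_bigr _ (fun s _ => es s)) (bigD1 (1%g : 'S_N.+1)) //= eqxx.
  by rewrite big1 ?addr0 // => s /negbTE ->.
have delta (f : I -> I -> K) (A B : I) :
    \sum_(E < N.+1) \sum_(F < N.+1) f E F * ((E == A)%:R * (F == B)%:R) = f A B.
  have inner E : \sum_(F < N.+1) f E F * ((E == A)%:R * (F == B)%:R)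
      = f E B * (E == A)%:R.
    rewrite (bigD1 B) //= eqxx mulr1 big1 ?addr0 // => F /negbTE ->.
    by rewrite !mulr0.
  rewrite (eq_bigr _ (fun E _ => inner E)) (bigD1 A) //= eqxx mulr1.
  by rewrite big1 ?addr0 // => E /negbTE ->; rewrite mulr0.
apply: (@qalg_neq0 _ _ _ e) => p [[A [B [C [D ->]]]]| -> | ->].
- have eR (c : I -> I -> K) (A1 B1 A2 B2 : I -> I -> I) :
      e (\sum_(E < N.+1) \sum_(F < N.+1)
           c E F *: (freeT (A1 E F) (B1 E F) * freeT (A2 E F) (B2 E F)))
      = \sum_(E < N.+1) \sum_(F < N.+1)
          c E F * ((A1 E F == B1 E F)%:R * (A2 E F == B2 E F)%:R).
    rewrite raddf_sum; apply: eq_bigr => E _.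
    by rewrite raddf_sum; apply: eq_bigr => F _; apply: eZM.
  rewrite eB; apply/eqP; rewrite subr_eq0; apply/eqP.
  apply: (etrans (eR _ (fun E _ => E) (fun _ _ => C) (fun _ F => F) (fun _ _ => D))).
  rewrite delta; apply: esym.
  apply: (etrans (eR (fun E F => Rmat E F C D)
    (fun _ _ => B) (fun _ F => F) (fun _ _ => A) (fun E _ => E))).
  rewrite -[RHS](delta (fun E F => Rmat E F C D)); apply: eq_bigr => E _.
  by apply: eq_bigr => F _; rewrite mulrC [A == E]eq_sym [B == F]eq_sym
    [X in X * _]mulrC mulrC.
- by rewrite eB rmorphM rmorph1 [X in X * _]eXi [X in _ * X]edet mulr1 subrr.
- by rewrite eB rmorphM rmorph1 [X in _ * X]eXi [X in X * _]edet mulr1 subrr.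
Qed.

HB.instance Definition _ := GRing.PzSemiRing_isNonZero.Build GL GL_neq0.
HB.instance Definition _ :=
  GRing.Lmodule_isLalgebra.Build K GL (@qalg_scalerAl _ _ GLrel).
HB.instance Definition _ :=
  GRing.Lalgebra_isAlgebra.Build K GL (@qalg_scalerAr _ _ GLrel).

Definition GL_gen (g : GLgen) : GL := qalg_pi GLrel (freegen K g).
Definition GL_T : 'M[GL]_N.+1 := \matrix_(A, B) GL_gen (Some (A, B)).
Definition GL_Xi : GL := GL_gen None.

Definition monomial (w : seq GLgen) : GL := \prod_(g <- w) GL_gen g.

Definition is_T0a (g : GLgen) : bool :=
  if g is Some (A, a) then (A == ord0) && (a != ord0) else false.

(* Monomials are words in all the generators, T^A_B and Xi. *)
Definition H_ideal : set GL :=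
  span [set x | exists2 w, has is_T0a w & x = monomial w]%classic.

End QuantumGL.

(* Main.v *)
From HB Require Import structures.
Require Import Defs.
From mathcomp Require Import all_boot all_order all_algebra.
From mathcomp Require Import complex reals.
From mathcomp Require Import perm finmap monalg boolp classical_sets.
Import GRing.Theory.
Local Open Scope ring_scope.

(** Ideal and co-ideal.  The words in the generators span the algebra, so the
span H of the words containing some T^0_a (a > 0) is a two-sided ideal.  The
counit kills T^0_a and
  Delta(T^0_a) = T^0_0 (x) T^0_a + sum_(c > 0) T^0_c (x) T^c_a
lies in the two-sided ideal of the tensor square spanned by the pure tensors
with a factor in H; as the coproduct and the counit are multiplicative, H is a
co-ideal ([word_span_coideal]).

Antipode.  In every Hopf algebra kappa(x y) = kappa(y) kappa(x)
([antipodeM]); the proof evaluates in two ways the sum over the iterated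
coproducts of x and y of
  kappa(x1 y1) x2 y2 kappa(y3) kappa(x3).
It therefore suffices that kappa(T^0_a) belongs to H ([word_span_antipode]).
Compute modulo H, where the first row of T is (T^0_0, 0, ..., 0).  The entry
(0, a) of T kappa(T) = 1 becomes T^0_0 kappa(T^0_a) = 0, so it is enough to
find a left inverse of T^0_0 ([inverse_first_row]).  The RTT relation with
indices (0 b; 0 d) says that T^0_0 commutes with T^b_d up to a scalar for
b, d > 0 ([T00_commute]).  A permutation with s(0) <> 0 contributes nothing to
det T modulo H, and in the other terms T^0_0 can be moved from the left end to
the right end; hence det T = y T^0_0 modulo H for some y
([qdet_right_factor]), and Xi y is a left inverse of T^0_0 because
Xi det T = 1. *)

Set Implicit Arguments.
Unset Strict Implicit.
Unset Printing Implicit Defensive.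

(* The name span also denotes the span of a sequence in a vector space. *)
Local Notation span := Defs.span.

(** * Linear functions and tensors *)

Section LinearFunctions.
Variables (K : fieldType) (U V W : lmodType K).

Lemma linear_comp {f : V -> W} {g : U -> V} :
  linear f -> linear g -> linear (fun x => f (g x)).
Proof. by move=> fL gL c x y; rewrite gL fL. Qed.

Lemma linear_fun (f : {linear U -> V}) : linear f.
Proof. by move=> c x y; rewrite linearP. Qed.

(** For a function whose linearity is a proposition, such as a bilinear map
with one argument fixed. *)
Lemma linear_sum (f : U -> V) I (s : seq I) (F : I -> U) :
  linear f -> f (\sum_(i <- s) F i) = \sum_(i <- s) f (F i).
Proof.
move=> fL; have f0 : f 0 = 0.
  by have := fL (-1) 0 0; rewrite !scaleN1r oppr0 addr0 addNr.
elim: s => [|i s IHs]; first by rewrite !big_nil f0.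
by rewrite !big_cons -IHs -[F i]scale1r fL !scale1r.
Qed.

Lemma linear_bigsum (I : Type) (s : seq I) (F : I -> U -> V) :
  (forall i, linear (F i)) -> linear (fun x => \sum_(i <- s) F i x).
Proof.
move=> FL c x y; rewrite scaler_sumr -big_split /=.
by apply: eq_bigr => i _; rewrite FL.
Qed.

End LinearFunctions.

Section Tensors.
Variables (K : fieldType) (A B : lmodType K).

Lemma tens_decomp (z : tens A B) :
  exists s : seq (A * B), z = \sum_(p <- s) p.1 ⊗ p.2.
Proof.
elim/tens_ind: z => [u v [s ->] [t ->]|a b].
  by exists (s ++ t); rewrite big_cat.
by exists [:: (a, b)]; rewrite big_seq1.
Qed.

End Tensors.

(** * The antipode reverses products *)

Section Antipode.
Variables (K : fieldType) (A : algType K) (S : hopf_structure A).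
Local Notation kappa := (antipode S).
Local Notation eps := (counit S).

(** A chosen decomposition of the coproduct of x into pure tensors: the
pairs (x1, x2) of Sweedler's notation. *)
Definition coterms (x : A) : seq (A * A) := projT1 (cid (tens_decomp (comul S x))).

Lemma comul_coterms x : comul S x = \sum_(p <- coterms x) p.1 ⊗ p.2.
Proof. by rewrite /coterms; case: cid. Qed.

Lemma tlift_coterms {V : lmodType K} (f : A -> A -> V) x :
  bilin f -> tlift f (comul S x) = \sum_(p <- coterms x) f p.1 p.2.
Proof.
move=> fB; rewrite comul_coterms linear_sum; last exact: tlift_lin.
by apply: eq_bigr => p _; rewrite tliftE.
Qed.

(** Coassociativity in Sweedler form: a trilinear f takes the same value on
both iterated coproducts. *)
Lemma coterms_coassoc {V : lmodType K} (f : A -> A -> A -> V) x :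
    (forall b c, linear (fun a => f a b c)) ->
    (forall a c, linear (fun b => f a b c)) ->
    (forall a b, linear (fun c => f a b c)) ->
  \sum_(p <- coterms x) \sum_(u <- coterms p.1) f u.1 u.2 p.2 =
  \sum_(p <- coterms x) \sum_(u <- coterms p.2) f p.1 u.1 u.2.
Proof.
move=> f1 f2 f3; pose F a y := tlift (f a) y.
have fB a : bilin (f a) by split.
have FB : bilin F.
  split=> [y c a a'|a]; last exact: tlift_lin.
  apply: (@tens_lin_ext _ _ _ _ (fun y => tlift _ y)
    (fun y => c *: tlift (f a) y + tlift (f a') y)).
  - exact: tlift_lin.
  - by apply: comb_linear; apply: tlift_lin.
  by move=> b b'; rewrite !tliftE // f1.
have := congr1 (tlift F) (comulA S x).
have L1 (g : A -> tens A A) : linear g -> bilin (fun a b => a ⊗ g b).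
  move=> gL; split=> [b c a a'|a c b b'].
    by rewrite tenDl tenZl.
  by rewrite gL tenDr tenZr.
have L2 (g : A -> tens A A) : linear g -> bilin (fun a b => g a ⊗ b).
  move=> gL; split=> [b c a a'|a c b b'].
    by rewrite gL tenDl tenZl.
  by rewrite tenDr tenZr.
have comL := linear_fun (comul S).
have idL : linear (@idfun A) by [].
have FL := tlift_lin FB.
have bil3 d : bilin (fun (a : A) (b : A) => a ⊗ (b ⊗ (d : A))).
  by split=> [y k a a'|y k a a']; rewrite ?(tenDl, tenDr, tenZl, tenZr).
have asL : linear (@tassoc K A A A).
  apply: tlift_lin; split=> [d|y k d d']; first exact: tlift_lin.
  apply: (@tens_lin_ext _ _ _ _ (tlift _) (fun y => k *: tlift _ y + tlift _ y)).
  - exact: tlift_lin.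
  - by apply: comb_linear; apply: tlift_lin.
  by move=> a a'; rewrite !tliftE // !(tenDr, tenZr).
rewrite /tmap !tlift_coterms; [|exact: L1|exact: L2].
rewrite (linear_sum _ _ asL) !(linear_sum _ _ FL).
move=> E; transitivity (\sum_(p <- coterms x) tlift F (tassoc (comul S p.1 ⊗ p.2))).
  apply: eq_bigr => p _; rewrite comul_coterms.
  have tL : linear (fun y : tens A A => y ⊗ p.2) by case: (ten_bilin (tens A A) A).
  rewrite (linear_sum _ _ tL) (linear_sum _ _ asL).
  rewrite (linear_sum _ _ FL); apply: eq_bigr => u _.
  by rewrite tassocE tliftE // /F tliftE.
rewrite E; apply: eq_bigr => p _.
by rewrite tliftE // /F tlift_coterms.
Qed.

Lemma coterms_counitl x : \sum_(p <- coterms x) eps p.1 *: p.2 = x.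
Proof.
rewrite -[RHS](counitl S) tlift_coterms //; split=> [b c a a'|a c b b'].
  by rewrite linearP scalerDl scalerA.
by rewrite scalerDr !scalerA mulrC.
Qed.

Lemma coterms_counitr x : \sum_(p <- coterms x) eps p.2 *: p.1 = x.
Proof.
rewrite -[RHS](counitr S) tlift_coterms //; split=> [b c a a'|a c b b'].
  by rewrite scalerDr !scalerA mulrC.
by rewrite linearP scalerDl scalerA.
Qed.

Lemma antipodel_bilin : bilin (fun a b => kappa a * b).
Proof.
split=> [b c a a'|a c b b'].
  by rewrite linearP mulrDl -scalerAl.
by rewrite mulrDr -scalerAr.
Qed.

Lemma coterms_antipoder x : \sum_(p <- coterms x) p.1 * kappa p.2 = (eps x)%:A.
Proof.
rewrite -(antipoder S) tlift_coterms //; split=> [b c a a'|a c b b'].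
  by rewrite mulrDl -scalerAl.
by rewrite linearP mulrDr -scalerAr.
Qed.

(** The left antipode axiom at x * y, with the coproduct of x * y expanded
as the product of the two coproducts. *)
Lemma coterms_antipodelM x y :
  \sum_(p <- coterms x) \sum_(u <- coterms y) kappa (p.1 * u.1) * (p.2 * u.2)
  = (eps x * eps y)%:A.
Proof.
rewrite -rmorphM -(antipodel S) rmorphM /= !comul_coterms mulr_suml.
rewrite (linear_sum _ _ (tlift_lin antipodel_bilin)).
apply: eq_bigr => p _; rewrite mulr_sumr.
rewrite (linear_sum _ _ (tlift_lin antipodel_bilin)).
by apply: eq_bigr => u _; rewrite [_ * _ in RHS]tmulE tliftE //; apply: antipodel_bilin.
Qed.

(** Both sides equal the sum of kappa(x1 y1) x2 y2 kappa(y3) kappa(x3): they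
are obtained by contracting the last two, respectively the first two, factors
of each iterated coproduct. *)
Lemma antipodeM (x y : A) : kappa (x * y) = kappa y * kappa x.
Proof.
pose f (a b c a' b' c' : A) := kappa (a * a') * (b * b') * (kappa c' * kappa c).
have mulL (U : lmodType K) (g : U -> A) c : linear g -> linear (fun a => c * g a).
  by move=> gL k a a'; rewrite gL mulrDr -scalerAr.
have mulR (U : lmodType K) (g : U -> A) c : linear g -> linear (fun a => g a * c).
  by move=> gL k a a'; rewrite gL mulrDl -scalerAl.
have kL (g : A -> A) : linear g -> linear (fun a => kappa (g a)).
  exact: linear_comp (linear_fun _).
(* The sum over the iterated coproduct of y only. *)
pose g a b c := \sum_(p <- coterms y) \sum_(u <- coterms p.2) f a b c p.1 u.1 u.2.
(* Contracting y2 kappa(y3), then x2 kappa(x3), gives kappa(x y). *)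
transitivity (\sum_(p <- coterms x) \sum_(u <- coterms p.2) g p.1 u.1 u.2).
  have gE a b c : g a b c = kappa (a * y) * (b * kappa c).
    rewrite -[in RHS](coterms_counitr y) /g.
    rewrite mulr_sumr linear_sum ?mulr_suml; last exact: linear_fun.
    apply: eq_bigr => p _; rewrite -scalerAr linearZ /= -scalerAl.
    transitivity (kappa (a * p.1) * b * (\sum_(u <- coterms p.2) u.1 * kappa u.2)
        * kappa c).
      by rewrite mulr_sumr mulr_suml; apply: eq_bigr => u _; rewrite /f !mulrA.
    by rewrite coterms_antipoder -scalerAr mulr1 -scalerAl mulrA.
  rewrite -[in LHS](coterms_counitr x) mulr_suml linear_sum; last exact: linear_fun.
  apply: eq_bigr => p _; rewrite -scalerAl linearZ /=.
  transitivity (kappa (p.1 * y) * (\sum_(u <- coterms p.2) u.1 * kappa u.2)).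
    by rewrite coterms_antipoder -scalerAr mulr1.
  by rewrite mulr_sumr; apply: eq_bigr => u _; rewrite gE.
(* Reassociate both iterated coproducts. *)
rewrite -(@coterms_coassoc _ g); last first.
- move=> a b; do 2!apply: linear_bigsum => ?.
  by apply: (mulL); apply: (mulL); apply: kL.
- move=> a c; do 2!apply: linear_bigsum => ?.
  by apply: (mulR); apply: (mulL); apply: (mulR).
- move=> b c; do 2!apply: linear_bigsum => ?.
  by apply: (mulR); apply: (mulR); apply: kL; apply: (mulR).
transitivity (\sum_(p <- coterms x) \sum_(p' <- coterms y)
   \sum_(u <- coterms p.1) \sum_(u' <- coterms p'.1)
      f u.1 u.2 p.2 u'.1 u'.2 p'.2).
  apply: eq_bigr => p _; rewrite [RHS]exchange_big /=; apply: eq_bigr => u _.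
  apply/esym/(coterms_coassoc (f := f u.1 u.2 p.2)).
  + move=> b c; apply: (mulR); apply: (mulR); apply: kL; exact: (mulL).
  + move=> a c; apply: (mulR); apply: (mulL); exact: (mulL).
  + move=> a b; apply: (mulL); apply: (mulR); exact: kL.
(* Contract kappa(x1 y1) x2 y2. *)
transitivity (\sum_(p <- coterms x) \sum_(p' <- coterms y)
   (eps p.1 * eps p'.1) *: (kappa p'.2 * kappa p.2)).
  apply: eq_bigr => p _; apply: eq_bigr => p' _.
  rewrite -[RHS]mul1r -scalerAr scalerAl -coterms_antipodelM mulr_suml.
  by apply: eq_bigr => u _; rewrite mulr_suml.
rewrite -[in RHS](coterms_counitl x) -[in RHS](coterms_counitl y).
rewrite !(linear_sum _ _ (linear_fun _)) mulr_suml exchange_big /=.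
apply: eq_bigr => p' _; rewrite mulr_sumr; apply: eq_bigr => p _.
by rewrite !linearZ /= -scalerAl -scalerAr scalerA mulrC.
Qed.

End Antipode.

(** * Ideals and co-ideals spanned by words *)

Lemma idealZ (K : fieldType) (A : algType K) (H : set A) c x :
  two_sided_ideal H -> H x -> H (c *: x).
Proof. by case=> _ _ HM Hx; rewrite -[x]mul1r scalerAl; apply: (HM _ _ Hx).1. Qed.

Section TensorIdeal.
Variables (K : fieldType) (A : algType K) (H : set A).
Hypothesis idealH : two_sided_ideal H.

(** The subspace H (x) A + A (x) H of the tensor square, as the span of the
pure tensors with at least one factor in H. *)
Definition tens_ideal : set (tens A A) :=
  span [set z | exists u v, (H u \/ H v) /\ z = u ⊗ v]%classic.

Lemma tens_idealM z t : tens_ideal z -> tens_ideal (t * z) /\ tens_ideal (z * t).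
Proof.
have [_ _ HM] := idealH.
apply: (@span_ind _ _ _ (fun z => tens_ideal (t * z) /\ tens_ideal (z * t))).
- by rewrite mulr0 mul0r; split; apply: span0.
- by move=> u v [? ?] [? ?]; rewrite mulrDr mulrDl; split; apply: spanD.
move=> c _ [u [v [Huv ->]]].
rewrite -tenZl; have {}Huv : H (c *: u) \/ H v.
  by case: Huv => [Hu|]; [left; apply: idealZ|right].
move: (c *: u) Huv => u' Huv.
elim/tens_ind: t => [t t' [? ?] [? ?]|a b].
  by rewrite mulrDr mulrDl; split; apply: spanD.
split; rewrite [_ * _]tmulE; apply: span_sub.
  exists (a * u'), (b * v); split=> //.
  by case: Huv => [/(HM a)[]|/(HM b)[]]; [left|right].
exists (u' * a), (v * b); split=> //.
by case: Huv => [/(HM a)[]|/(HM b)[]]; [left|right].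
Qed.

Lemma tens_ideal_split z : tens_ideal z ->
  exists y t, [/\ tens_sub H setT y, tens_sub setT H t & z = y + t].
Proof.
apply: (@span_ind _ _ _ (fun z => exists y t,
  [/\ tens_sub H setT y, tens_sub setT H t & z = y + t])).
- by exists 0, 0; split; rewrite ?addr0 //; apply: span0.
- move=> _ _ [y [t [Hy Ht ->]]] [y' [t' [Hy' Ht' ->]]].
  by exists (y + y'), (t + t'); split; [apply: spanD|apply: spanD|apply: addrACA].
move=> c _ [u [v [[Hu|Hv] ->]]].
  exists (c *: (u ⊗ v)), 0; split; rewrite ?addr0 //; last exact: span0.
  by apply/spanZ/span_sub; exists u, v.
exists 0, (c *: (u ⊗ v)); split; rewrite ?add0r //; first exact: span0.
by apply/spanZ/span_sub; exists u, v.
Qed.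

End TensorIdeal.

Section WordIdeal.
Variables (K : fieldType) (A : algType K) (G : Type) (gen : G -> A) (P : pred G).

(** The span of the words in the generators gen that contain at least one
generator satisfying P. *)
Definition word_span : set A :=
  span [set x | exists2 w, has P w & x = \prod_(g <- w) gen g]%classic.

Lemma word_span_gen g : P g -> word_span (gen g).
Proof. by move=> Pg; apply: span_sub; exists [:: g]; rewrite ?big_seq1 //= Pg. Qed.

(* The generators generate A. *)
Hypothesis gen_span : forall x, span [set x | exists w, x = \prod_(g <- w) gen g]%classic x.

Lemma word_span_ideal : two_sided_ideal word_span.
Proof.
split=> [|x y|a x Hx]; [exact: span0|exact: spanD|].
apply: (@span_ind _ _ _ (fun a => word_span (a * x) /\ word_span (x * a))) (gen_span a).
- by rewrite mulr0 mul0r; split; apply: span0.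
- by move=> u v [? ?] [? ?]; rewrite mulrDr mulrDl; split; apply: spanD.
move=> c _ [w ->].
apply: (@span_ind _ _ _ (fun x => word_span (_ * x) /\ word_span (x * _))) Hx.
- by rewrite mulr0 mul0r; split; apply: span0.
- by move=> u v [? ?] [? ?]; rewrite mulrDr mulrDl; split; apply: spanD.
move=> c' _ [w' Pw' ->]; rewrite -scalerAl -scalerAr -scalerAl -scalerAr -!big_cat /=.
by split; do 2!apply: spanZ; apply: span_sub;
  [exists (w ++ w')|exists (w' ++ w)]; rewrite ?has_cat ?Pw' ?orbT.
Qed.

Variable S : hopf_structure A.

Lemma word_span_coideal :
  (forall g, P g -> tens_ideal word_span (comul S (gen g))) ->
  (forall g, P g -> counit S (gen g) = 0) -> coideal S word_span.
Proof.
move=> comP epsP; split=> x.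
  move=> Hx; apply: (tens_ideal_split).
  move: Hx; apply: (@span_ind _ _ _ (fun x => tens_ideal word_span (comul S x))).
  - by rewrite raddf0; apply: span0.
  - by move=> u v ? ?; rewrite raddfD; apply: spanD.
  move=> c _ [w Pw ->]; rewrite linearZ /= rmorph_prod; apply: spanZ.
  elim: w Pw => //= g w IHw /orP[Pg|Pw]; rewrite big_cons.
    by apply: (tens_idealM word_span_ideal _ (comP g Pg)).2.
  by apply: (tens_idealM word_span_ideal _ (IHw Pw)).1.
apply: (@span_ind _ _ _ (fun x => counit S x = 0)).
- by rewrite raddf0.
- by move=> u v eu ev; rewrite raddfD /= eu ev addr0.
move=> c _ [w Pw ->]; rewrite linearZ /= rmorph_prod.
elim: w Pw => //= g w IHw /orP[Pg|Pw]; rewrite big_cons.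
  by rewrite epsP // mul0r mulr0.
by rewrite mulrCA IHw // mulr0.
Qed.

Lemma word_span_antipode : (forall g, P g -> word_span (antipode S (gen g))) ->
  forall x, word_span x -> word_span (antipode S x).
Proof.
move=> SP; have [_ _ HM] := word_span_ideal.
apply: (@span_ind _ _ _ (fun x => word_span (antipode S x))).
- by rewrite linear0; apply: span0.
- by move=> u v ? ?; rewrite linearD; apply: spanD.
move=> c _ [w Pw ->]; rewrite linearZ /=; apply: spanZ.
elim: w Pw => //= g w IHw /orP[Pg|Pw]; rewrite big_cons antipodeM.
  by apply: (HM _ _ (SP g Pg)).1.
by apply: (HM _ _ (IHw Pw)).2.
Qed.

End WordIdeal.

(** * Matrices whose first row is zero off the diagonal modulo an ideal *)

Section FirstRow.
Variables (K : fieldType) (A : algType K) (H : set A) (N : nat) (t : 'M[A]_N.+1).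
Hypothesis idealH : two_sided_ideal H.
Hypothesis t0H : forall a, a != ord0 -> H (t ord0 a).

Let HD x y : H x -> H y -> H (x + y).
Proof. by case: idealH => _ HD _; apply: HD. Qed.

Let HMl a x : H x -> H (a * x).
Proof. by case: idealH => _ _ HM /(HM a)[]. Qed.

Let HMr a x : H x -> H (x * a).
Proof. by case: idealH => _ _ HM /(HM a)[]. Qed.

(** If u commutes up to scalars with every factor modulo H, it can be moved
from the left to the right of the product; the scalars are absorbed in y. *)
Lemma prod_right_factor (u : A) n (x : 'I_n -> A) :
    (forall i, exists k, H (u * x i - k *: (x i * u))) ->
  exists y, H (u * \prod_(i < n) x i - y * u).
Proof.
elim: n x => [|n IHn] x xT.
  by exists 1; rewrite big_ord0 mulr1 mul1r subrr; case: idealH.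
have [y Hy] := IHn (fun i => x (lift ord0 i)) (fun i => xT _).
have [k Hk] := xT ord0.
exists ((k *: x ord0) * y); rewrite big_ord_recl /=.
set p := \prod_(i < n) _ in Hy *.
have -> : u * (x ord0 * p) - k *: x ord0 * y * u =
    (u * x ord0 - k *: (x ord0 * u)) * p + (k *: x ord0) * (u * p - y * u).
  by rewrite mulrBl mulrBr -!scalerAl !mulrA addrA subrK.
by apply: HD; [apply: HMr|apply: HMl].
Qed.

(** The terms with s(0) <> 0 start with an off-diagonal entry of the first
row, hence lie in H. *)
Lemma qdet_right_factor r q :
    (forall b d, b != ord0 -> d != ord0 ->
       exists k, H (t ord0 ord0 * t b d - k *: (t b d * t ord0 ord0))) ->
  exists y, H (qdet r q t - y * t ord0 ord0).
Proof.
move=> comm_t; rewrite /qdet; elim/big_rec: _ => [|s z _ [y Hy]].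
  by exists 0; rewrite mul0r subrr; case: idealH.
set k := \prod_(p | _) _.
suff [y' Hy'] : exists y', H (\prod_(a < N.+1) t a (s a) - y' * t ord0 ord0).
  exists (k *: y' + y); rewrite mulrDl opprD addrACA -scalerAl -scalerBr.
  by apply: HD => //; apply: (idealZ _ idealH).
rewrite big_ord_recl; case: (eqVneq (s ord0) ord0) => [s0|s0]; last first.
  by exists 0; rewrite mul0r subr0; apply/HMr/t0H.
rewrite s0; apply: prod_right_factor => i; apply: comm_t => //.
by rewrite -[X in _ != X]s0 (inj_eq perm_inj).
Qed.

(** Modulo H, x * y is a left inverse of t 0 0, while t 0 0 * t' 0 a = 0. *)
Lemma inverse_first_row (t' : 'M[A]_N.+1) (x d y : A) a :
    t *m t' = 1%:M -> x * d = 1 -> H (d - y * t ord0 ord0) ->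
  a != ord0 -> H (t' ord0 a).
Proof.
move=> tt' xd Hd a0.
have Ht : H (t ord0 ord0 * t' ord0 a).
  have := congr1 (fun M : 'M_N.+1 => M ord0 a) tt'.
  rewrite !mxE (eq_sym _ a) (negbTE a0) (bigD1 ord0) //= => /eqP.
  rewrite addr_eq0 => /eqP ->; rewrite -scaleN1r; apply: (idealZ _ idealH).
  elim/big_rec: _ => [|c z c0 Hz]; first by case: idealH.
  by apply: HD => //; apply/HMr/t0H.
rewrite -[t' _ _]mul1r -xd -mulrA; apply: HMl.
rewrite -[d](subrK (y * t ord0 ord0)) mulrDl -mulrA.
by apply: HD; [apply: HMr|apply: HMl].
Qed.

End FirstRow.

Lemma idealZ_comm (K : fieldType) (A : algType K) (H : set A) (x y z : A) (c k k' : K) :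
    two_sided_ideal H -> c != 0 -> H z -> c *: x = k *: y + k' *: z ->
  H (x - (c^-1 * k) *: y).
Proof.
move=> idealH c0 Hz E.
have -> : x = c^-1 *: (c *: x) by rewrite scalerA mulVf ?scale1r.
rewrite E -scalerA -scalerBr addrAC subrr add0r.
by do 2!apply: (idealZ _ idealH).
Qed.

(** * Contractions of the R-matrix *)

Section RMatrix.
Variables (K : fieldType) (N : nat) (r : K) (q : 'I_N.+1 -> 'I_N.+1 -> K).
Variables (V : lmodType K) (F : 'I_N.+1 -> 'I_N.+1 -> V).

(** In the row (0, b) the off-diagonal part of R vanishes, because theta
requires 0 > b. *)
Lemma sum_Rmat_row0 b : b != ord0 ->
  \sum_(e < N.+1) \sum_(f < N.+1) Rmat r q ord0 b e f *: F e f =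
  (r / q ord0 b) *: F ord0 b.
Proof.
move=> b0; rewrite (bigD1 ord0) //= [X in _ + X]big1 ?addr0; last first.
  move=> e e0; apply: big1 => f _.
  by rewrite /Rmat eq_sym (negbTE e0) ltn0 !(mulr0, mul0r) addr0 scale0r.
rewrite (bigD1 b) //= [X in _ + X]big1 ?addr0; last first.
  move=> f fb.
  by rewrite /Rmat (eq_sym b f) (negbTE fb) ltn0 !(mulr0, mul0r) addr0 scale0r.
by rewrite /Rmat !eqxx (eq_sym _ b) (negbTE b0) ltn0 !(mulr0, mul0r, mul1r, addr0).
Qed.

(** In the column (0, d) the off-diagonal part of R contributes the single
entry in row (d, 0). *)
Lemma sum_Rmat_col0 d : d != ord0 ->
  \sum_(e < N.+1) \sum_(f < N.+1) Rmat r q e f ord0 d *: F e f =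
  (r / q ord0 d) *: F ord0 d + (r - r^-1) *: F d ord0.
Proof.
move=> d0; rewrite (bigD1 ord0) //= (bigD1 d) //= [X in _ + X + _]big1 ?addr0; last first.
  move=> e ed.
  by rewrite /Rmat (negbTE ed) ltn0 !(mulr0, mul0r) addr0 scale0r.
rewrite {1}/Rmat !eqxx (eq_sym _ d) (negbTE d0) ltn0 !(mulr0, mul0r, mul1r, addr0).
congr (_ + _); rewrite (bigD1 d) //= [X in _ + X]big1 ?addr0; last first.
  move=> e /andP[e0 ed]; apply: big1 => f _.
  by rewrite /Rmat (negbTE e0) (negbTE ed) !(mulr0, mul0r) addr0 scale0r.
rewrite (bigD1 ord0) //= [X in _ + X]big1 ?addr0; last first.
  move=> f f0.
  by rewrite /Rmat (negbTE f0) (negbTE d0) !(mulr0, mul0r) addr0 scale0r.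
by rewrite /Rmat !eqxx (negbTE d0) lt0n d0 !(mulr0, mul0r, mulr1, add0r).
Qed.

End RMatrix.

(** * The quantum general linear group *)

Lemma malg_monomialZ (K : fieldType) (M : choiceType) (c : K) (m : M) :
  << c *g m >> = c *: << m >>.
Proof. by apply/malgP => k; rewrite mcoeffZ !mcoeffU mulrnAr mulr1. Qed.

Section QuantumGL.
Variables (K : fieldType) (N : nat) (r : K) (q : 'I_N.+1 -> 'I_N.+1 -> K).
Local Notation A := (GL r q).
Local Notation T := (GL_T r q).
Local Notation Xi := (GL_Xi r q).
Local Notation H := (@H_ideal K N r q).
Local Notation I := 'I_N.+1.

(** The projection of the free algebra onto its quotient, with the carrier GL
as codomain so that it is a morphism of algebras into GL. *)
Definition GL_pi (x : freealg K (GLgen N)) : A := qalg_pi (GLrel r q) x.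

Lemma GL_pi_is_zmod : zmod_morphism GL_pi.
Proof. by move=> x y; apply: raddfB. Qed.
HB.instance Definition _ := GRing.isZmodMorphism.Build _ _ GL_pi GL_pi_is_zmod.
Lemma GL_pi_is_monoid : monoid_morphism GL_pi.
Proof. exact: qalg_pi_monoid. Qed.
HB.instance Definition _ := GRing.isMonoidMorphism.Build _ _ GL_pi GL_pi_is_monoid.
Lemma GL_pi_is_scalable : scalable GL_pi.
Proof. exact: qpi_scalable. Qed.
HB.instance Definition _ := GRing.isScalable.Build _ _ _ _ GL_pi GL_pi_is_scalable.

Lemma GL_pi_linear : linear GL_pi.
Proof. exact: linear_fun. Qed.

Lemma GL_piT a b : GL_pi (freeT K N a b) = T a b.
Proof. by rewrite !mxE. Qed.

Lemma GL_pi_rel x y : GLrel r q (x - y) -> GL_pi x = GL_pi y.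
Proof.
by move=> rx; apply/qpiP/span_sub; exists 1, (x - y), 1; rewrite mul1r mulr1.
Qed.

Lemma GL_pi_quadratic (c : I -> I -> K) (a b a' b' : I -> I -> I) :
  GL_pi (\sum_(e < N.+1) \sum_(f < N.+1)
    c e f *: (freeT K N (a e f) (b e f) * freeT K N (a' e f) (b' e f))) =
  \sum_(e < N.+1) \sum_(f < N.+1) c e f *: (T (a e f) (b e f) * T (a' e f) (b' e f)).
Proof.
rewrite (linear_sum _ _ GL_pi_linear); apply: eq_bigr => e _.
rewrite (linear_sum _ _ GL_pi_linear); apply: eq_bigr => f _.
by rewrite GL_pi_is_scalable GL_pi_is_monoid.2 !GL_piT.
Qed.

Lemma GL_RTT a b c d :
  \sum_(e < N.+1) \sum_(f < N.+1) Rmat r q a b e f *: (T e c * T f d) =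
  \sum_(e < N.+1) \sum_(f < N.+1) Rmat r q e f c d *: (T b f * T a e).
Proof.
have rel : GLrel r q (\sum_(e < N.+1) \sum_(f < N.+1)
    Rmat r q a b e f *: (freeT K N e c * freeT K N f d)
  - \sum_(e < N.+1) \sum_(f < N.+1)
    Rmat r q e f c d *: (freeT K N b f * freeT K N a e)).
  by apply: Or31; exists a, b, c, d.
transitivity (GL_pi (\sum_(e < N.+1) \sum_(f < N.+1)
    Rmat r q a b e f *: (freeT K N e c * freeT K N f d))).
  exact/esym/(GL_pi_quadratic _ (fun e _ => e) (fun _ _ => c) (fun _ f => f) (fun _ _ => d)).
apply: etrans (GL_pi_rel rel) _.
exact: (GL_pi_quadratic _ (fun _ _ => b) (fun _ f => f) (fun _ _ => a) (fun e _ => e)).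
Qed.

Lemma GL_pi_qdet : GL_pi (qdet r q (freeT K N)) = qdet r q T.
Proof.
rewrite /qdet (linear_sum _ _ GL_pi_linear); apply: eq_bigr => s _.
rewrite GL_pi_is_scalable rmorph_prod.
by congr (_ *: _); apply: eq_bigr => i _; apply: GL_piT.
Qed.

Lemma GL_Xi_qdet : Xi * qdet r q T = 1.
Proof.
rewrite -GL_pi_qdet; apply: etrans (esym (rmorphM GL_pi (freeXi K N) _)) _.
by apply: etrans (rmorph1 GL_pi); apply: GL_pi_rel; apply: Or32.
Qed.

Lemma GL_gen_span (x : A) :
  span [set x | exists w, x = \prod_(g <- w) GL_gen r q g]%classic x.
Proof.
have [g ->] : {g | x = GL_pi g} by apply: qalg_surj.
rewrite [g : {malg K[{fmonom _}]}]monalgE (linear_sum _ _ GL_pi_linear).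
elim: (enum_fset _) => [|m s IHs]; first by rewrite big_nil; apply: span0.
rewrite big_cons; apply: spanD IHs.
rewrite malg_monomialZ GL_pi_is_scalable; apply: spanZ; apply: span_sub; exists (m : seq _).
rewrite /GL_gen -[RHS]/(\prod_(g <- m) GL_pi (freegen K g)) -rmorph_prod.
congr GL_pi; case: m => w; elim: w => [|g' w IHw] /=.
  rewrite big_nil; apply/esym; congr << _ >>; by rewrite -[LHS]fmK fm1.
rewrite big_cons -IHw [RHS]malgM_def fgmulUU mulr1; congr << _ >>.
by rewrite -[RHS]fmK fmM fmU.
Qed.

Lemma H_ideal_two_sided : two_sided_ideal H.
Proof. exact: word_span_ideal GL_gen_span. Qed.

Lemma H_T0a a : a != ord0 -> H (T ord0 a).
Proof. by move=> a0; rewrite mxE; apply: word_span_gen => /=; rewrite a0. Qed.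

Hypothesis r_neq0 : r != 0.
Hypothesis q_neq0 : forall a b, q a b != 0.

(** The RTT relation with indices (0 b; 0 d), whose extra term
T^b_0 T^0_d lies in H. *)
Lemma T00_commute b d : b != ord0 -> d != ord0 ->
  exists k, H (T ord0 ord0 * T b d - k *: (T b d * T ord0 ord0)).
Proof.
move=> b0 d0; have [_ _ HM] := H_ideal_two_sided.
have c0 : r / q ord0 b != 0 by rewrite mulf_neq0 ?invr_eq0.
have E : (r / q ord0 b) *: (T ord0 ord0 * T b d) =
    (r / q ord0 d) *: (T b d * T ord0 ord0) + (r - r^-1) *: (T b ord0 * T ord0 d).
  apply: etrans (sum_Rmat_col0 r q (fun e f => T b f * T ord0 e) d0).
  by apply: etrans (GL_RTT ord0 b ord0 d); apply/esym/(sum_Rmat_row0 r q _ b0).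
exists ((r / q ord0 b)^-1 * (r / q ord0 d)).
apply: (idealZ_comm H_ideal_two_sided c0 _ E).
exact: (HM _ _ (H_T0a d0)).1.
Qed.

Lemma H_antipode_T0a (S : hopf_structure A) a :
  T *m map_mx (antipode S) T = 1%:M -> a != ord0 -> H (antipode S (T ord0 a)).
Proof.
move=> TS a0.
have [y Hy] := qdet_right_factor H_ideal_two_sided H_T0a r q T00_commute.
have := inverse_first_row H_ideal_two_sided H_T0a TS GL_Xi_qdet Hy a0.
by rewrite mxE.
Qed.

Lemma H_comul_T0a (S : hopf_structure A) a :
    (forall b c, comul S (T b c) = \sum_(d < N.+1) T b d ⊗ T d c) ->
  a != ord0 -> tens_ideal H (comul S (T ord0 a)).
Proof.
move=> comT a0; rewrite comT; elim/big_rec: _ => [|d z _ Hz]; first exact: span0.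
apply: spanD => //; apply: span_sub; exists (T ord0 d), (T d a); split=> //.
by case: (eqVneq d ord0) => [->|d0]; [right|left]; apply: H_T0a.
Qed.

End QuantumGL.

Unset Implicit Arguments.

Theorem theorem3p3p1 (R : realType) (N : nat) (r : R[i])
    (q : 'I_N.+1 -> 'I_N.+1 -> R[i])
    (r_neq0 : r != 0) (q_neq0 : forall A B, q A B != 0)
    (q_inv : forall A B, q A B = r ^+ 2 / q B A) (q_diag : forall A, q A A = r)
    (S : hopf_structure (GL r q))
    (comulT : forall A B, comul S (GL_T r q A B)
       = \sum_(C < N.+1) GL_T r q A C ⊗ GL_T r q C B)
    (counitT : forall A B, counit S (GL_T r q A B) = (A == B)%:R)
    (antipodeTl : map_mx (antipode S) (GL_T r q) *m GL_T r q = 1%:M)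
    (antipodeTr : GL_T r q *m map_mx (antipode S) (GL_T r q) = 1%:M)
    (comulXi : comul S (GL_Xi r q) = GL_Xi r q ⊗ GL_Xi r q)
    (counitXi : counit S (GL_Xi r q) = 1)
    (antipodeXi : antipode S (GL_Xi r q) = qdet r q (GL_T r q)) :
  hopf_ideal S (@H_ideal R[i] N r q).
Proof.
have genT A B : GL_gen r q (Some (A, B)) = GL_T r q A B by rewrite mxE.
have T0P (Q : GLgen N -> Prop) :
    (forall a, a != ord0 -> Q (Some (ord0, a))) -> forall g, is_T0a g -> Q g.
  by move=> QT [[A a]|//] /= /andP[/eqP -> /QT].
split; first exact: H_ideal_two_sided.
- apply: (word_span_coideal (@GL_gen_span _ _ r q)); apply: T0P => a a0.
    by rewrite genT; apply: H_comul_T0a.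
  by rewrite genT counitT eq_sym (negbTE a0).
- move=> _ [x Hx <-].
  apply: (word_span_antipode (@GL_gen_span _ _ r q) _ Hx); apply: T0P => a a0.
  by rewrite genT; apply: H_antipode_T0a.
Qed.
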